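(* (1) ${}^\perp\mathbb{Q}$ is the class of all abelian groups. (2) ${}^\perp(\mathbb{Z}^\omega/\mathbb{Z}^{(\omega)})=\bigcap_{p\in P}{}^\perp J_p$, where $P$ is the set of all primes. (3) For every cardinal $\kappa$, ${}^\perp(\mathbb{Z}^\kappa/B^{<\infty})={}^\perp\mathbb{Q}$, where $B^{<\infty}$ is the subgroup of $\mathbb{Z}^\kappa$ consisting of the bounded functions.
   Context: All groups are abelian. For a group $X$, ${}^\perp X$ denotes the class of all abelian groups $G$ with $\mathrm{Ext}(G,X)=0$. $\mathbb{Z}^\omega$ is the direct product and $\mathbb{Z}^{(\omega)}$ the direct sum of countably many copies of $\mathbb{Z}$. $J_p$ is the group of $p$-adic integers. Elements of $\mathbb{Z}^\kappa$ are functions $\kappa\to\mathbb{Z}$. *)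

(* Defs.v *)
From HB Require Import structures.
From mathcomp Require Export all_boot all_order all_algebra.
From mathcomp Require Export boolp classical_sets functions cardinality.

Set Implicit Arguments.
Unset Strict Implicit.
Unset Printing Implicit Defensive.

Import Order.TTheory GRing.Theory Num.Theory.
Local Open Scope classical_set_scope.
Local Open Scope ring_scope.

(* Short exact sequences 0 -> X -> E -> G -> 0 of abelian groups. *)
Record extension (G X : zmodType) := Extension {
  ext_mid : zmodType;
  ext_inj : {additive X -> ext_mid};
  ext_prj : {additive ext_mid -> G};
  ext_injP : injective ext_inj;
  ext_prjP : forall g : G, exists e : ext_mid, ext_prj e = g;
  ext_exact : forall e : ext_mid,
    ext_prj e = 0 <-> exists x : X, ext_inj x = e }.

Definition ext_equiv (G X : zmodType) (E F : extension G X) : Prop :=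
  exists f : {additive ext_mid E -> ext_mid F},
    [/\ bijective f,
        forall x : X, f (ext_inj E x) = ext_inj F x &
        forall e : ext_mid E, ext_prj F (f e) = ext_prj E e].

Section SplitExtension.
Variables G X : zmodType.

Definition split_inj (x : X) : X * G := (x, 0).
Definition split_prj (e : X * G) : G := e.2.

Fact split_inj_additive : zmod_morphism split_inj.
Proof. by move=> x y; congr pair; rewrite /= subr0. Qed.

Fact split_prj_additive : zmod_morphism split_prj.
Proof. by []. Qed.

HB.instance Definition _ :=
  GRing.isZmodMorphism.Build X (X * G)%type split_inj split_inj_additive.
HB.instance Definition _ :=
  GRing.isZmodMorphism.Build (X * G)%type G split_prj split_prj_additive.

Fact split_injP : injective split_inj.
Proof. by move=> x y []. Qed.

Fact split_prjP (g : G) : exists e, split_prj e = g.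
Proof. by exists (0, g). Qed.

Fact split_exact (e : X * G) : split_prj e = 0 <-> exists x, split_inj x = e.
Proof.
case: e => x g; split=> [/= g0|[y [_ <-]] //].
by exists x; rewrite /split_inj -g0.
Qed.

Definition split_extension : extension G X :=
  @Extension G X (X * G)%type split_inj split_prj
    split_injP split_prjP split_exact.

End SplitExtension.

(* The underlying set of Ext(G, X), whose elements are the equivalence classes
   of extensions.  The zero of the Baer sum is the class of the split
   extension.  These are plain Prop-valued predicates because the universe
   constraints of the library rule out [set (extension G X)]. *)
Record Ext (G X : zmodType) := ExtClass {
  ext_class : extension G X -> Prop;
  ext_classP : exists E, ext_class = ext_equiv E }.

Definition Ext_zero (G X : zmodType) : Ext G X :=
  ExtClass (ex_intro _ (split_extension G X) erefl).

(* [perp X G] reads: G belongs to the class of all G with Ext(G, X) = 0. *)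
Definition perp (X G : zmodType) : Prop :=
  forall c : Ext G X, c = Ext_zero G X.

Section Subgroups.
Variable K : Type.

Definition finsupp_fun : {pred K -> int} :=
  [pred f | `[< finite_set [set k | f k != 0] >]].

Definition bounded_Zfun : {pred K -> int} :=
  [pred f | `[< exists m : int, forall k, `|f k| <= m >]].

Fact finsupp_fun_closed : zmod_closed finsupp_fun.
Proof.
split=> [|f g /asboolP fF /asboolP gF]; apply/asboolP.
  by apply: sub_finite_set (finite_set0 K) => k /= /eqP.
have fgF : finite_set ([set k | f k != 0] `|` [set k | g k != 0]).
  by rewrite finite_setU.
apply: sub_finite_set fgF => k /=.
case: (eqVneq (f k) 0) => [fk0|]; last by left.
case: (eqVneq (g k) 0) => [gk0|]; last by right.
have -> : (f - g) k = f k - g k by [].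
by rewrite fk0 gk0 subrr eqxx.
Qed.

Fact bounded_Zfun_closed : zmod_closed bounded_Zfun.
Proof.
split=> [|f g /asboolP[m fm] /asboolP[n gn]]; apply/asboolP.
  by exists 0 => k; rewrite normr0.
exists (m + n) => k; have -> : (f - g) k = f k - g k by [].
exact: le_trans (ler_normB _ _) (lerD (fm k) (gn k)).
Qed.

HB.instance Definition _ :=
  GRing.isZmodClosed.Build (K -> int) finsupp_fun finsupp_fun_closed.
HB.instance Definition _ :=
  GRing.isZmodClosed.Build (K -> int) bounded_Zfun bounded_Zfun_closed.

End Subgroups.

Definition quot_finsupp (K : Type) : zmodType :=
  Quotient.quot (@finsupp_fun K : zmodClosed (K -> int)).

Definition quot_bounded (K : Type) : zmodType :=
  Quotient.quot (@bounded_Zfun K : zmodClosed (K -> int)).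

(* J_p is the inverse limit of the groups Z/p^(n+1), n >= 0.  The index is
   shifted by one because 'Z_(p ^ 0) denotes Z/2; the encoding is only
   meaningful for p > 1. *)
Section PadicIntegers.
Variable p : nat.

Definition padic_proj (n : nat) (x : 'Z_(p ^ n.+2)) : 'Z_(p ^ n.+1) := inZp x.

Record padic := Padic {
  padic_coord :> forall n : nat, 'Z_(p ^ n.+1);
  padic_coherent : forall n, padic_proj (padic_coord n.+1) = padic_coord n }.

Fact padic_ext (x y : padic) : (forall n, x n = y n) -> x = y.
Proof.
case: x y => [x hx] [y hy] /= xy.
have {}xy : x = y by apply: functional_extensionality_dep.
by case: y / xy hy => hy; rewrite (Prop_irrelevance hx hy).
Qed.

Fact padic_proj_dvd n : ((Zp_trunc (p ^ n.+1)).+2 %| (Zp_trunc (p ^ n.+2)).+2)%N.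
Proof.
have [p1|p1] := ltnP 1 p; first by rewrite !Zp_cast ?dvdn_exp2l // -?(expn0 p) ?ltn_exp2l.
by case: p p1 => [|[|]] // _; rewrite ?exp0n ?exp1n.
Qed.

Fact padic_proj_additive n : zmod_morphism (@padic_proj n).
Proof.
have inB (a b : 'Z_(p ^ n.+2)) : padic_proj (a + b) = padic_proj a + padic_proj b.
  apply: val_inj => /=; rewrite modn_dvdm ?padic_proj_dvd //.
  by rewrite modnDml modnDmr.
by move=> a b; apply: (addIr (padic_proj b)); rewrite -inB !subrK.
Qed.

HB.instance Definition _ n := GRing.isZmodMorphism.Build
  'Z_(p ^ n.+2) 'Z_(p ^ n.+1) (@padic_proj n) (@padic_proj_additive n).

Fact padic_zero_subproof n : @padic_proj n 0 = 0. Proof. exact: raddf0. Qed.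
Definition padic_zero := Padic padic_zero_subproof.

Fact padic_opp_subproof (x : padic) n : padic_proj (- x n.+1) = - x n.
Proof. by rewrite raddfN /= padic_coherent. Qed.
Definition padic_opp x := Padic (padic_opp_subproof x).

Fact padic_add_subproof (x y : padic) n :
  padic_proj (x n.+1 + y n.+1) = x n + y n.
Proof. by rewrite raddfD /= !padic_coherent. Qed.
Definition padic_add x y := Padic (padic_add_subproof x y).

Fact padic_addA : associative padic_add.
Proof. by move=> x y z; apply: padic_ext => n; apply: addrA. Qed.
Fact padic_addC : commutative padic_add.
Proof. by move=> x y; apply: padic_ext => n; apply: addrC. Qed.
Fact padic_add0 : left_id padic_zero padic_add.
Proof. by move=> x; apply: padic_ext => n; apply: add0r. Qed.
Fact padic_addN : left_inverse padic_zero padic_opp padic_add.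
Proof. by move=> x; apply: padic_ext => n; apply: addNr. Qed.

HB.instance Definition _ := gen_eqMixin padic.
HB.instance Definition _ := gen_choiceMixin padic.
HB.instance Definition _ :=
  GRing.isZmodule.Build padic padic_addA padic_addC padic_add0 padic_addN.

End PadicIntegers.

(* Main.v *)
(* Divisible groups are injective (Zorn on partial additive maps); rat and
   Z^K/B^{<oo} are divisible, since f = n * (f div n) + (f mod n) with a bounded
   remainder.  This settles (1) and (3).
   In (2) both sides say that G is torsion-free; J_p alone detects p-torsion.
   If X <> pX and G has an element g of order p, embed X in a divisible D, take
   d in D with pd in X \ pX, extend g |-> d + X to G -> D/X and pull back
   D -> D/X along it: this extension of G by X does not split.  Conversely:
   - when G has no p-torsion, a retraction onto J_p = Hom(Z(p^oo), Q/Z) is a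
     coherent sequence of characters f_n with p f_(n+1) = f_n, built one at a
     time by injectivity of Q/Z;
   - when G is torsion-free, a partial retraction onto X = Z^N/Z^(N) with pure
     domain M extends to the pure closure of M + Za: modulo M that closure is
     the union of a chain of cyclic groups, so one must solve a sequence of
     equations x_k = t_k x_(k+1) + c_k in X.  At each coordinate i the
     equations k <= i can be solved downwards from x_(i+1) = 0, and these
     solutions are correct modulo finitely supported functions. *)
From HB Require Import structures.
Require Import Defs.

Set Implicit Arguments.
Unset Strict Implicit.
Unset Printing Implicit Defensive.

Import Order.TTheory GRing.Theory Num.Theory.
Local Open Scope classical_set_scope.
Local Open Scope ring_scope.

(** * Vanishing of Ext as splitting of extensions *)

Lemma exists_additive (A B : zmodType) (f : A -> B) :
  zmod_morphism f -> exists g : {additive A -> B}, g =1 f.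
Proof.
move=> fB; pose m := GRing.isZmodMorphism.Build A B f fB.
by exists (HB.pack f m : {additive A -> B}).
Qed.

Lemma ext_equiv_sym (G X : zmodType) (E F : extension G X) :
  ext_equiv E F -> ext_equiv F E.
Proof.
case=> f [[g fK gK] fi fp].
have [h hE] : exists h : {additive ext_mid F -> ext_mid E}, h =1 g.
  apply: exists_additive => x y.
  by apply: (can_inj fK); rewrite raddfB /= !gK.
exists h; split=> [|x|e].
- by exists f => e; rewrite hE.
- by rewrite hE -fi fK.
- by rewrite hE -{2}(gK e) fp.
Qed.

Lemma ext_equiv_trans (G X : zmodType) (E F H : extension G X) :
  ext_equiv E F -> ext_equiv F H -> ext_equiv E H.
Proof.
case=> f [bf fi fp] [g [bg gi gp]].
exists (g \o f : {additive ext_mid E -> ext_mid H}); split=> [|x|e] /=.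
- exact: bij_comp.
- by rewrite fi gi.
- by rewrite gp fp.
Qed.

(** A retraction [r] gives the map [e |-> (r e, ext_prj E e)]. Its inverse starts from any
    set-theoretic section of the projection and corrects it by an element of [X]. *)
Lemma ext_equiv_splitP (G X : zmodType) (E : extension G X) :
  ext_equiv E (split_extension G X) <->
  exists r : {additive ext_mid E -> X}, forall x, r (ext_inj E x) = x.
Proof.
split=> [[f [_ fi _]]|[r ri]].
  have [r rE] : exists r : {additive ext_mid E -> X}, r =1 fun e => (f e).1.
    by apply: exists_additive => x y; rewrite raddfB.
  by exists r => x; rewrite rE fi.
have [f fE] : exists f : {additive ext_mid E -> ext_mid (split_extension G X)},
    f =1 fun e => (r e, ext_prj E e).
  by apply: exists_additive => x y; congr pair; rewrite raddfB.
have prj_inj x : ext_prj E (ext_inj E x) = 0.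
  by apply/ext_exact; exists x.
exists f; split=> [|x|e]; last by rewrite fE.
- pose s (u : X * G) := sval (cid (ext_prjP E u.2)).
  have sP u : ext_prj E (s u) = u.2 by rewrite /s; case: cid.
  exists (fun u => s u + ext_inj E (u.1 - r (s u))) => [e|u]; last first.
    rewrite fE; case: u => x g; congr pair; rewrite raddfD /=.
      by rewrite ri addrC subrK.
    by rewrite prj_inj addr0 sP.
  rewrite fE; set u := (_, _).
  have /ext_exact[x xE] : ext_prj E (e - s u) = 0 by rewrite raddfB /= sP subrr.
  by rewrite -[u.1]/(r e) -raddfB -xE ri xE addrC subrK.
- by rewrite fE ri prj_inj.
Qed.

(** Classes in [Ext G X] are predicates, so once every extension splits, extensionality identifies
    each class with that of the split extension. *)
Lemma perpP (X G : zmodType) :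
  perp X G <-> forall E : extension G X,
    exists r : {additive ext_mid E -> X}, forall x, r (ext_inj E x) = x.
Proof.
split=> [XG E|XG [c cP]].
  apply/ext_equiv_splitP.
  have /(congr1 (@ext_class G X)) /= EE :=
    XG (ExtClass (ex_intro _ E erefl)).
  by rewrite EE; exists idfun; split => //; exists idfun.
have {XG}split_ext F : ext_equiv F (split_extension G X).
  exact/ext_equiv_splitP.
have cS : c = ext_equiv (split_extension G X).
  case: cP => E ->; apply: functional_extensionality_dep => F.
  apply: propositional_extensionality.
  split=> _; apply: (ext_equiv_trans (split_ext _)).
    exact: ext_equiv_sym.
  exact: ext_equiv_sym.
by subst c; congr ExtClass; apply: Prop_irrelevance.
Qed.

(** * Subgroups of the integers and extension of partial additive maps *)

(** The generator is the least positive element, by division with remainder, or 0 if there is no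
    positive element. *)
Lemma int_subgroup_generator (H : set int) :
  H 0 -> (forall m n, H m -> H n -> H (m - n)) ->
  exists2 m, H m & forall n, H n -> exists q, n = q * m.
Proof.
move=> H0 HB.
have HN n : H n -> H (- n) by rewrite -sub0r; apply: HB.
have HD m n : H m -> H n -> H (m + n) by rewrite -{2}(opprK n) => ? /HN; apply: HB.
have HM q n : H n -> H (q * n).
  move=> Hn; suff Hk k : H (k%:Z * n).
    by case: q => k //; rewrite NegzE mulNr; apply: HN.
  elim: k => [|k IHk]; first by rewrite mul0r.
  by rewrite intS mulrDl mul1r; apply: HD.
have [[k Hk]|noH] := pselect (exists k : nat, H k.+1%:Z); last first.
  exists 0 => // -[[|n]|n] Hn; first by exists 0.
    by case: noH; exists n.
  by case: noH; exists n; rewrite -[X in H X]opprK -NegzE; apply: HN.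
have exk : exists k, `[< H k.+1%:Z >] by exists k; apply/asboolP.
case: (ex_minnP exk) => m /asboolP Hm mmin.
exists m.+1%:Z => // n Hn; exists (n %/ m.+1%:Z)%Z.
rewrite {1}(divz_eq n m.+1); set r := (n %% _)%Z.
have Hr : H r.
  have -> : r = n - (n %/ m.+1)%Z * m.+1.
    by rewrite [X in X - _](divz_eq n m.+1) addrAC subrr add0r.
  by apply: HB => //; apply: HM.
have : r < m.+1%:Z by rewrite ltz_mod.
have : 0 <= r by rewrite modz_ge0.
case: r Hr => // -[|r] Hr _; first by rewrite addr0.
rewrite ltz_nat => rm; have := mmin r; rewrite asboolT // => /(_ isT).
by move: rm; rewrite !ltnS => /leq_trans h /h; rewrite ltnn.
Qed.

(* [S] is a set of integers by which the domain of the relation is closed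
   under division; it is empty for injectivity of divisible groups, and the
   set of nonzero integers for pure subgroups. *)
Record partial_additive (A B : zmodType) (S : set int) (R : set (A * B)) : Prop :=
  PartialAdditive {
    pa0 : R (0, 0);
    paB : forall u v, R u -> R v -> R (u - v);
    pa_fun : forall b, R (0, b) -> b = 0;
    pa_pure : forall n a b, S n -> R (a *~ n, b) -> exists c, R (a, c) }.

Section PartialAdditive.
Variables (A B : zmodType) (S : set int) (R : set (A * B)).
Hypothesis RP : partial_additive S R.

Lemma paN u : R u -> R (- u).
Proof. by move=> Ru; rewrite -sub0r; apply: (paB RP) Ru; apply: pa0 RP. Qed.

Lemma paD u v : R u -> R v -> R (u + v).
Proof. by move=> Ru Rv; rewrite -(opprK v); apply: (paB RP) => //; apply: paN. Qed.

Lemma paMz u n : R u -> R (u *~ n).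
Proof.
move=> Ru; suff Rk k : R (u *+ k) by case: n => n; [|apply: paN]; apply: Rk.
by elim: k => [|k IHk]; [apply: pa0 RP | rewrite mulrS; apply: paD].
Qed.

Lemma pa_uniq a b c : R (a, b) -> R (a, c) -> b = c.
Proof.
move=> Rb /(paB RP Rb) Rbc; apply/subr0_eq/(pa_fun RP).
by move: Rbc; congr R; congr pair; rewrite /= subrr.
Qed.

End PartialAdditive.

Lemma total_partial_additive (A B : zmodType) (S : set int) (R : set (A * B)) :
  partial_additive S R -> (forall a, exists b, R (a, b)) ->
  exists f : {additive A -> B}, forall a b, R (a, b) -> f a = b.
Proof.
move=> RP /choice[f fR].
have [g gE] : exists g : {additive A -> B}, g =1 f.
  apply: exists_additive => x y; apply: (pa_uniq RP (fR _)).
  exact: (paB RP (fR x) (fR y)).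
by exists g => a b ab; rewrite gE; apply: (pa_uniq RP (fR a)).
Qed.

(** Zorn's lemma on graphs ordered by inclusion: the second hypothesis forces a maximal graph to be
    total. *)
Lemma partial_additive_extend (A B : zmodType) (S : set int) (R : set (A * B)) :
  partial_additive S R ->
  (forall R' a, partial_additive S R' -> R `<=` R' ->
     exists2 R'', partial_additive S R'' & R' `<=` R'' /\ exists b, R'' (a, b)) ->
  exists f : {additive A -> B}, forall a b, R (a, b) -> f a = b.
Proof.
move=> RP step.
pose P := [set R' : set (A * B) | R' = set0 \/ partial_additive S R' /\ R `<=` R'].
have [F FP Ftot|M [PM Mmax]] := @Zorn_bigcup _ P.
  have [[R1 FR1 [u R1u]]|F0] := pselect (exists2 R1, F R1 & R1 !=set0); last first.
    left; rewrite -subset0 => u [R1 FR1 R1u]; apply: F0.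
    by exists R1 => //; exists u.
  have FP' R2 v : F R2 -> R2 v -> partial_additive S R2 /\ R `<=` R2.
    by move=> /FP[->|].
  have [R1P RR1] := FP' _ _ FR1 R1u.
  right; split; last by move=> v Rv; exists R1 => //; apply: RR1.
  split.
  - by exists R1 => //; apply: pa0 R1P.
  - move=> v w [R2 FR2 R2v] [R3 FR3 R3w].
    have [R23|R32] := Ftot _ _ FR2 FR3.
      have [R3P _] := FP' _ _ FR3 R3w.
      by exists R3 => //; apply: (paB R3P) => //; apply: R23.
    have [R2P _] := FP' _ _ FR2 R2v.
    by exists R2 => //; apply: (paB R2P) => //; apply: R32.
  - by move=> b [R2 FR2 R2b]; have [/pa_fun R2P _] := FP' _ _ FR2 R2b; apply: R2P.
  - move=> n a b Sn [R2 FR2 R2ab].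
    have [/pa_pure R2P _] := FP' _ _ FR2 R2ab.
    by have [c R2ac] := R2P _ _ _ Sn R2ab; exists c; exists R2.
have {PM}[MP RM] : partial_additive S M /\ R `<=` M.
  case: PM => // M0; case: (Mmax R); last by right; split=> // u.
  rewrite M0; split; first exact: sub0set.
  by move=> R0; apply: (R0 _ (pa0 RP)).
have [|f fM] := total_partial_additive MP; last first.
  by exists f => a b /RM; apply: fM.
move=> a; have [R' R'P [MR' [b R'ab]]] := step _ a MP RM.
exists b; apply: contrapT => Mab; apply: (Mmax R').
  by split=> // R'M; apply/Mab/R'M.
by right; split=> //; apply: subset_trans MR'.
Qed.

(** For a subgroup [R], this is the subgroup generated by [R] and [u]. *)
Definition adjoin (A B : zmodType) (R : set (A * B)) (u : A * B) : set (A * B) :=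
  [set v | exists n : int, R (v - u *~ n)].

Section Adjoin.
Variables (A B : zmodType) (S : set int) (R : set (A * B)) (u : A * B).
Hypothesis RP : partial_additive S R.

Lemma adjoinB v w : adjoin R u v -> adjoin R u w -> adjoin R u (v - w).
Proof.
move=> [m Rm] [n Rn]; exists (m - n).
by rewrite mulrzBr opprD addrACA -opprD; apply: (paB RP).
Qed.

Lemma sub_adjoin : R `<=` adjoin R u.
Proof. by move=> v Rv; exists 0; rewrite mulr0z subr0. Qed.

Lemma mem_adjoin : adjoin R u u.
Proof. by exists 1; rewrite mulr1z subrr; apply: (pa0 RP). Qed.

End Adjoin.

Lemma pair_mulrz (A B : zmodType) (a : A) (b : B) (n : int) :
  (a, b) *~ n = (a *~ n, b *~ n).
Proof.
have nat_case k : (a, b) *+ k = (a *+ k, b *+ k).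
  by elim: k => [|k IHk] //; rewrite !mulrS IHk.
by case: n => k; rewrite /intmul ?nat_case.
Qed.

(** * Divisible groups: injectivity and examples *)

Definition divisible (D : zmodType) :=
  forall (n : int) (d : D), n != 0 -> exists c, c *~ n = d.

(** To reach a new point [a], let [m] generate the group of integers [n] with [a *~ n] in the
    domain. The value at [a *~ m], divided by [m], is a consistent value at [a]. *)
Lemma divisible_injective (A D : zmodType) (R : set (A * D)) :
  divisible D -> partial_additive set0 R ->
  exists f : {additive A -> D}, forall a d, R (a, d) -> f a = d.
Proof.
move=> Ddiv RP; apply: (partial_additive_extend RP) => {RP}R' a RP _.
pose H := [set n | exists d, R' (a *~ n, d)].
have [||m [e Re] Hm] := @int_subgroup_generator H.
- by exists 0; rewrite mulr0z; apply: pa0 RP.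
- move=> m n [d Rd] [d' Rd']; exists (d - d').
  by rewrite mulrzBr; apply: (paB RP Rd Rd').
have [d dm] : exists d, d *~ m = e.
  have [m0|/Ddiv//] := eqVneq m 0.
  (* For [m = 0] no nonzero multiple of [a] is in the domain, so any value is consistent. *)
  exists 0; rewrite mul0rz; apply/esym/(pa_fun RP).
  by move: Re; rewrite m0 mulr0z.
have Hd n b : R' (a *~ n, b) -> b = d *~ n.
  move=> Rb; have [q nE] := Hm n (ex_intro _ b Rb).
  apply: (pa_uniq RP Rb); have := paMz RP q Re.
  by rewrite pair_mulrz -dm -!mulrzA -!(mulrC q) -nE.
exists (adjoin R' (a, d)); last first.
  by split; [exact: sub_adjoin | exists d; apply: mem_adjoin RP].
split=> //.
- exact/sub_adjoin/(pa0 RP).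
- exact: adjoinB RP.
move=> b [n]; rewrite pair_mulrz /= => Rn.
apply: (addIr (- (d *~ n))); rewrite add0r -[RHS]mulrNz; apply: Hd.
by move: Rn; congr R'; congr pair; rewrite /= sub0r mulrNz.
Qed.

Lemma ext_prj_inj (G X : zmodType) (E : extension G X) x :
  ext_prj E (ext_inj E x) = 0.
Proof. by apply/ext_exact; exists x. Qed.

(** The inverse of the injection is a partial map defined on its image; a total extension of it is a
    retraction. *)
Lemma perp_divisible (D G : zmodType) : divisible D -> perp D G.
Proof.
move=> Ddiv; apply/perpP => E.
pose R := [set u : ext_mid E * D | u.1 = ext_inj E u.2].
have [|r rR] := divisible_injective (R := R) Ddiv; last by exists r => x; apply: rR.
rewrite /R; split=> //= [|[a b] [c d] /= -> ->|b].
- by rewrite raddf0.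
- by rewrite raddfB.
- by rewrite -(raddf0 (ext_inj E)) => /ext_injP.
Qed.

Lemma divisible_rat : divisible rat.
Proof.
by move=> n q n0; exists (q / n%:~R); rewrite -mulrzr divfK ?intr_eq0.
Qed.

Lemma fct_mulrz (K : Type) (V : zmodType) (f : K -> V) (n : int) (k : K) :
  (f *~ n) k = f k *~ n.
Proof.
have nat_case m : (f *+ m) k = f k *+ m by rewrite natmulfctE.
by case: n => m; rewrite /intmul -?nat_case.
Qed.

Lemma divisible_fct (K : Type) (D : zmodType) : divisible D -> divisible (K -> D).
Proof.
move=> Ddiv n f n0.
have [g gn] := choice (fun k => Ddiv n (f k) n0).
by exists g; apply: functional_extensionality_dep => k; rewrite fct_mulrz.
Qed.

Section QuotientProjection.
Variables (V : zmodType) (I : zmodClosed V).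

Definition qproj : {additive V -> Quotient.quot I} := \pi_(Quotient.quot I)%qT.

Lemma qproj_surj y : exists x, qproj x = y.
Proof. by exists (repr y); apply: reprK. Qed.

Lemma qproj_eq0 x : qproj x = 0 <-> x \in I.
Proof.
by rewrite -(raddf0 qproj) -{2}[x]subr0 Quotient.idealrBE; split=> [->|/eqP].
Qed.

Lemma divisible_quot : divisible V -> divisible (Quotient.quot I).
Proof.
move=> Vdiv n y /Vdiv Vn; have [x <-] := qproj_surj y.
by have [z <-] := Vn x; exists (qproj z); rewrite -raddfMz.
Qed.

End QuotientProjection.

Lemma divisible_quot_bounded (K : Type) : divisible (quot_bounded K).
Proof.
move=> n y n0; have [f <-] := qproj_surj y.
exists (qproj _ (fun k => (f k %/ n)%Z)).
rewrite -raddfMz; apply/subr0_eq; rewrite -raddfB; apply/qproj_eq0/asboolP.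
exists `|n| => k.
have -> (g h : K -> int) : (g - h) k = g k - h k by [].
rewrite fct_mulrz -mulrzr intz distrC {1}(divz_eq (f k) n) addrAC subrr add0r.
by rewrite ger0_norm ?modz_ge0 // ltW // ltz_mod.
Qed.

(** * The group Q/Z and embeddings into divisible groups *)

Definition int_rat : {pred rat} := [pred q | q \is a Num.int].

Fact int_rat_closed : zmod_closed int_rat.
Proof. by split=> [|q r qZ rZ]; rewrite inE ?rpred0 ?rpredB. Qed.

HB.instance Definition _ := GRing.isZmodClosed.Build rat int_rat int_rat_closed.

Definition QZ : zmodType := Quotient.quot (int_rat : zmodClosed rat).
Definition toQZ : {additive rat -> QZ} := qproj _.

Lemma toQZ_eq0 q : toQZ q = 0 <-> q \is a Num.int.
Proof. exact: qproj_eq0. Qed.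

Lemma divisible_QZ : divisible QZ.
Proof. exact/divisible_quot/divisible_rat. Qed.

Lemma torsion_QZ (n : int) (y : QZ) : n != 0 -> y *~ n = 0 ->
  exists m : int, y = toQZ (m%:~R / n%:~R).
Proof.
move=> n0; have [q <-] := qproj_surj y.
rewrite -raddfMz => /toQZ_eq0/intrP[m qm].
by exists m; rewrite -qm -mulrzr mulfK ?intr_eq0.
Qed.

(** By injectivity of Q/Z, it suffices to define a character on the cyclic group of [x], sending [x]
    to a nonzero element killed by the order of [x]. *)
Lemma QZ_separates (X : zmodType) (x : X) :
  x != 0 -> exists f : {additive X -> QZ}, f x != 0.
Proof.
move=> x0.
have [||m Hm mgen] := @int_subgroup_generator [set n | x *~ n = 0].
- by rewrite /= mulr0z.
- by move=> m n /= xm xn; rewrite mulrzBr xm xn subrr.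
(* The value at [x] will be the class of [1 / k]; for [x] of infinite order, 1/2 serves. *)
pose k : int := if m == 0 then 2 else m.
have k0 : k != 0 by rewrite /k; have [|] := eqVneq m 0.
have [c [c0 cm]] : exists c : QZ, c != 0 /\ c *~ m = 0.
  exists (toQZ k%:~R^-1); split.
    apply/eqP => /toQZ_eq0/intrP[q kq].
    have kq1 : k * q = 1.
      by apply/eqP; rewrite -(eqr_int rat) intrM -kq divff ?intr_eq0.
    have kunit : `|k|%N = 1%N.
      have := congr1 absz kq1; rewrite abszM => /eqP.
      by rewrite muln_eq1 => /andP[/eqP].
    (* Only [m = 1] and [m = -1] remain, and both give [x = 0]. *)
    move: kunit; rewrite /k; case: eqP => // _ m1.
    case/eqP: x0; case: m m1 Hm {mgen k k0 kq kq1} => [[|[|n]]|[|n]] //= _.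
    by move=> /eqP; rewrite oppr_eq0 => /eqP.
  have [->|m0] := eqVneq m 0; first exact: mulr0z.
  rewrite -raddfMz /k (negbTE m0) -mulrzr mulVf ?intr_eq0 //.
  exact/toQZ_eq0/int_num1.
pose R := [set u : X * QZ | exists n, u = (x, c) *~ n].
have [|f fR] := divisible_injective (R := R) divisible_QZ; last first.
  by exists f; rewrite (fR _ c) //; exists 1; rewrite mulr1z.
split=> //.
- by exists 0; rewrite mulr0z.
- by move=> u v [n ->] [n' ->]; exists (n - n'); rewrite mulrzBr.
move=> b [n]; rewrite pair_mulrz => -[xn ->].
have [q ->] := mgen n (esym xn).
by rewrite mulrC mulrzA cm mul0rz.
Qed.

(** Evaluation embeds [X] in the product of copies of Q/Z indexed by the characters of [X]. *)
Lemma divisible_embedding (X : zmodType) :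
  exists D : zmodType, divisible D /\ exists i : {additive X -> D}, injective i.
Proof.
exists ({additive X -> QZ} -> QZ); split; first exact/divisible_fct/divisible_QZ.
have [i iE] : exists i : {additive X -> ({additive X -> QZ} -> QZ)},
    i =1 fun x f => f x.
  apply: exists_additive => x y; apply: functional_extensionality_dep => f.
  by rewrite raddfB.
exists i; apply: raddf_inj => x ix; apply: contrapT => /eqP/QZ_separates[f].
by rewrite -[f x]/((fun f : {additive X -> QZ} => f x) f) -iE ix eqxx.
Qed.

(** * Pullbacks of extensions and detection of torsion *)

Section Image.
Variables (X D : zmodType) (i : {additive X -> D}).

Definition image_pred : {pred D} := [pred d | `[< exists x, i x = d >]].

Fact image_pred_closed : zmod_closed image_pred.
Proof.
split=> [|_ _ /asboolP[x <-] /asboolP[y <-]]; apply/asboolP.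
  by exists 0; rewrite raddf0.
by exists (x - y); rewrite raddfB.
Qed.

HB.instance Definition _ :=
  GRing.isZmodClosed.Build D image_pred image_pred_closed.

End Image.

Section Pullback.
Variables (D G Q : zmodType) (f : {additive D -> Q}) (g : {additive G -> Q}).

Definition pullback_pred : {pred D * G} := [pred u | f u.1 == g u.2].

Fact pullback_pred_closed : zmod_closed pullback_pred.
Proof.
split=> [|u v /eqP fu /eqP fv]; apply/eqP; first by rewrite !raddf0.
by rewrite /= !raddfB fu fv.
Qed.

HB.instance Definition _ :=
  GRing.isZmodClosed.Build (D * G)%type pullback_pred pullback_pred_closed.

Record pullback := Pullback {
  pullback_val : D * G;
  pullback_valP : pullback_val \in pullback_pred }.

HB.instance Definition _ := [isSub for pullback_val].
HB.instance Definition _ := [Choice of pullback by <:].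
HB.instance Definition _ := [SubChoice_isSubZmodule of pullback by <:].

End Pullback.

(** The middle group is the fibre product of [D] and [G] over [Q], with [q] its other projection.
    The kernel of its projection to [G] is that of [f], a copy of [X]. *)
Lemma pullback_extension (X D G Q : zmodType) (i : {additive X -> D})
    (f : {additive D -> Q}) (g : {additive G -> Q}) :
  injective i -> (forall y, exists d, f d = y) ->
  (forall d, f d = 0 <-> exists x, i x = d) ->
  exists E : extension G X, exists q : {additive ext_mid E -> D},
    (forall x, q (ext_inj E x) = i x) /\
    forall d a, f d = g a -> exists2 e, q e = d & ext_prj E e = a.
Proof.
move=> iI fsurj fker.
have jP x : (i x, 0) \in pullback_pred f g.
  by apply/eqP; rewrite raddf0; apply/fker; exists x.
have [j jE] : exists j : {additive X -> pullback f g},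
    j =1 fun x => Pullback (jP x).
  apply: exists_additive => x y; apply: val_inj; rewrite /= raddfB.
  by congr pair; rewrite subrr.
have [p pE] : exists p : {additive pullback f g -> G}, p =1 fun u => (val u).2.
  by apply: exists_additive => u v; rewrite raddfB.
have [q qE] : exists q : {additive pullback f g -> D}, q =1 fun u => (val u).1.
  by apply: exists_additive => u v; rewrite raddfB.
have jI : injective j by move=> x y; rewrite !jE => -[/iI].
have psurj a : exists u, p u = a.
  have [d fd] := fsurj (g a).
  have uP : (d, a) \in pullback_pred f g by apply/eqP.
  by exists (Pullback uP); rewrite pE.
have exact u : p u = 0 <-> exists x, j x = u.
  rewrite pE; split=> [u2|[x <-]]; last by rewrite jE.
  have /eqP := pullback_valP u; rewrite [(pullback_val u).2]u2 raddf0.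
  move=> /fker[x xu]; exists x; apply: val_inj; rewrite jE /= xu.
  by move: u2 => /=; case: (pullback_val u) => d a /= ->.
exists (Extension jI psurj exact), q; split=> [x|d a fd]; first by rewrite qE jE.
have uP : (d, a) \in pullback_pred f g by apply/eqP.
by exists (Pullback uP); rewrite ?qE /= ?pE.
Qed.

(** In the pullback, an element [e] over the pair [(d, g)] has [e *+ p] equal to the image of [x]; a
    retraction [r] would then give [r e *+ p = x]. *)
Lemma perp_torsion_free (X G : zmodType) (p : nat) (x : X) : prime p ->
  (forall y, y *+ p <> x) -> perp X G -> forall g : G, g *+ p = 0 -> g = 0.
Proof.
move=> p_pr xp /perpP XG g gp; apply: contrapT => /eqP g0.
have p0 : p%:Z != 0 by rewrite eqz_nat -lt0n prime_gt0.
have [D [Ddiv [i iI]]] := divisible_embedding X.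
have [d dp] := Ddiv p (i x) p0.
pose Q := Quotient.quot (@image_pred _ _ i : zmodClosed D).
pose f : {additive D -> Q} := qproj _.
have fker e : f e = 0 <-> exists y, i y = e.
  by rewrite qproj_eq0; split=> /asboolP.
pose R := [set u : G * Q | exists n, u = (g, f d) *~ n].
have [|phi phiR] := divisible_injective (R := R) (divisible_quot Ddiv).
  split=> //.
  - by exists 0; rewrite mulr0z.
  - by move=> u v [n ->] [n' ->]; exists (n - n'); rewrite mulrzBr.
  move=> b [n]; rewrite pair_mulrz => -[gn ->].
  (* The partial map [g |-> f d] is well defined: by Bezout [g] has order exactly [p], and [p] kills
     [f d]. *)
  have /dvdzP[q ->] : (p %| n)%Z.
    apply: contraT => pn; case/eqP: g0.
    have /coprimezP[[u v] /= uv] : coprimez p n.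
      by rewrite coprimezE prime_coprime.
    rewrite -[g]mulr1z -uv mulrzDr (mulrC u) (mulrC v) !mulrzA -pmulrn gp -gn.
    by rewrite !mul0rz addr0.
  rewrite mulrC mulrzA -[f d *~ _]raddfMz dp.
  have -> : f (i x) = 0 by apply/fker; exists x.
  exact: mul0rz.
have [E [q [qi qsurj]]] := pullback_extension phi iI (@qproj_surj _ _) fker.
have [r ri] := XG E.
have [e qe ge] : exists2 e, q e = d & ext_prj E e = g.
  by apply: qsurj; rewrite (phiR _ (f d)) //; exists 1; rewrite mulr1z.
have /ext_exact[y yE] : ext_prj E (e *+ p) = 0 by rewrite raddfMn /= ge.
have yx : y = x by apply: iI; rewrite -qi yE raddfMn /= qe pmulrn.
by apply: (xp (r e)); rewrite -raddfMn /= -yE ri.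
Qed.

(** * The p-adic integers as coherent sequences of characters *)

Lemma toQZ_fracP (N : nat) (a b : int) : (0 < N)%N ->
  toQZ (a%:~R / N%:R) = toQZ (b%:~R / N%:R) <-> (a = b %[mod N])%Z.
Proof.
move=> N0; have N0' : (N%:R : rat) != 0 by rewrite pnatr_eq0 -lt0n.
have toE : toQZ (a%:~R / N%:R) = toQZ (b%:~R / N%:R) <->
    (a%:~R - b%:~R) / N%:R \is a @Num.int rat.
  rewrite mulrBl; split=> [ab|/toQZ_eq0]; last by rewrite raddfB => /subr0_eq.
  by apply/toQZ_eq0; rewrite raddfB ab subrr.
apply: (iff_trans toE).
rewrite -intrB; split=> [/intrP[q qE]|/eqP].
  apply/eqP; rewrite eqz_mod_dvd; apply/dvdzP; exists q.
  by apply/eqP; rewrite -(eqr_int rat) intrM -qE divfK.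
by rewrite eqz_mod_dvd => /Qint_dvdz.
Qed.

Lemma toQZ_natfracP (N a b : nat) : (0 < N)%N ->
  toQZ (a%:R / N%:R) = toQZ (b%:R / N%:R) <-> a = b %[mod N].
Proof.
move=> N0; rewrite (toQZ_fracP a b N0) !modz_nat.
by split=> [[]|->].
Qed.

Lemma torsion_QZ_nat (N : nat) (y : QZ) : (0 < N)%N -> y *+ N = 0 ->
  exists a : nat, y = toQZ (a%:R / N%:R).
Proof.
move=> N0 yN; have [||m ->] := @torsion_QZ N y; rewrite ?eqz_nat -?lt0n //.
exists `|(m %% N)%Z|%N; apply: (proj2 (toQZ_fracP m `|(m %% N)%Z|%N N0)).
by rewrite gez0_abs ?modz_mod // modz_ge0 // eqz_nat -lt0n.
Qed.

(* Identifies J_p with the group of homomorphisms from Z(p^oo) to Q/Z: such a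
   homomorphism is a sequence [y] as below, and [chi n x] is the class of
   x / p^n. *)
Lemma padic_characters (p : nat) : prime p ->
  exists chi : nat -> {additive padic p -> QZ},
  [/\ forall x, chi 0%N x = 0,
      forall n x, chi n.+1 x *+ p = chi n x,
      forall x, (forall n, chi n x = 0) -> x = 0 &
      forall y : nat -> QZ, y 0%N = 0 -> (forall n, y n.+1 *+ p = y n) ->
        exists x, forall n, chi n x = y n].
Proof.
move=> p_pr; have p1 := prime_gt1 p_pr.
have pX n : (0 < p ^ n)%N by rewrite expn_gt0 prime_gt0.
have pX1 n : (1 < p ^ n.+1)%N by rewrite -(expn0 p) ltn_exp2l.
have pR n : ((p ^ n)%:R : rat) != 0 by rewrite pnatr_eq0 -lt0n.
have coh (x : padic p) n : (x n.+1 %% p ^ n.+1)%N = x n.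
  by rewrite -(padic_coherent x n) /=; congr modn; rewrite Zp_cast.
have modS a b n : a = b %[mod p ^ n.+1] -> a = b %[mod p ^ n].
  by move=> ab; rewrite -(modn_dvdm a (dvdn_exp2l p (leqnSn n))) ab modn_dvdm ?dvdn_exp2l.
have divp a n : toQZ (a%:R / (p ^ n.+1)%:R) *+ p = toQZ (a%:R / (p ^ n)%:R).
  rewrite -raddfMn; congr (toQZ _); rewrite -[_ *+ p]mulr_natr expnS natrM.
  by rewrite invfM mulrA mulrAC divfK // pnatr_eq0 -lt0n prime_gt0.
(* Coordinate [n] is known modulo [p ^ n.+1], one power more than the denominator requires; [modS]
   discards the excess. *)
pose chi n (x : padic p) := toQZ ((x n : nat)%:R / (p ^ n)%:R).
have chiD n x y : chi n (x + y) = chi n x + chi n y.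
  rewrite -raddfD -mulrDl -natrD; apply/toQZ_natfracP => //; apply: modS.
  have -> : (x + y) n = ((x n + y n) %% p ^ n.+1)%N :> nat.
    by rewrite -[(x + y) n]/(x n + y n) /=; congr modn; rewrite Zp_cast.
  exact: modn_mod.
have chiB n : zmod_morphism (chi n).
  by move=> x y; apply: (addIr (chi n y)); rewrite -chiD !subrK.
have /choice[f fE] n := exists_additive (chiB n).
exists f; split=> [x|n x|x x0|y y0 yp].
- rewrite fE; apply/toQZ_eq0; rewrite expn0 divr1; exact: natr_int.
- rewrite !fE divp; apply/toQZ_natfracP => //; apply: modS.
  by rewrite -(coh x n) modn_mod.
(* Coordinate [n] is coordinate [n.+1] modulo [p ^ n.+1], which is what [chi n.+1] determines. *)
- apply: padic_ext => n; apply: val_inj => /=; rewrite -(coh x n).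
  have := x0 n.+1; rewrite fE -(raddf0 toQZ) -(mul0r (p ^ n.+1)%:R^-1).
  by move=> /(toQZ_natfracP _ 0 (pX _)) ->; rewrite mod0n.
have ypX n : y n *+ p ^ n = 0.
  by elim: n => [|n IHn]; rewrite ?y0 // expnS mulrnA yp.
have [a aE] := choice (fun n => torsion_QZ_nat (pX n) (ypX n)).
have acoh n : a n.+1 = a n %[mod p ^ n].
  by apply/toQZ_natfracP => //; rewrite -divp -!aE yp.
(* The numerator [a n.+1], known modulo [p ^ n.+1], supplies coordinate [n]. *)
have xP n : padic_proj ((a n.+2)%:R : 'Z_(p ^ n.+2)) = (a n.+1)%:R.
  apply: val_inj; rewrite /= !val_Zp_nat // Zp_cast //.
  by rewrite modn_dvdm ?dvdn_exp2l.
exists (Padic xP) => n; rewrite fE aE /chi /= val_Zp_nat //.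
by apply/toQZ_natfracP => //; rewrite modn_dvdm ?dvdn_exp2l.
Qed.

(** Both requirements prescribe [f'] on the subgroup [pE + iX]. They are compatible because
    [e *+ p + i x = 0] forces [e = i y] and [x = - (y *+ p)]; divisibility of [D] then extends the
    map. *)
Lemma extend_along_division (X E D : zmodType) (i : {additive X -> E}) (p : nat)
    (c c' : {additive X -> D}) (f : {additive E -> D}) :
  divisible D -> injective i ->
  (forall e x, e *+ p = i x -> exists y, i y = e) ->
  (forall x, c' x *+ p = c x) -> (forall x, f (i x) = c x) ->
  exists f' : {additive E -> D},
    (forall x, f' (i x) = c' x) /\ (forall e, f' e *+ p = f e).
Proof.
move=> Ddiv iI ipure cc' fi.
pose R := [set u : E * D | exists e x, u = (e *+ p + i x, f e + c' x)].
have [|f' f'R] := divisible_injective (R := R) Ddiv; last first.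
  exists f'; split=> [x|e].
    by apply: f'R; exists 0, x; rewrite mul0rn !raddf0 !add0r.
  rewrite -raddfMn; apply: f'R; exists e, 0.
  by rewrite !raddf0 !addr0.
split=> //.
- by exists 0, 0; rewrite mul0rn !raddf0 !addr0.
- move=> _ _ [e [x ->]] [e' [x' ->]]; exists (e - e'), (x - x').
  by congr pair; rewrite /= ?mulrnBl !raddfB /= opprD addrACA.
move=> b [e [x [/esym/eqP]]]; rewrite addr_eq0 -raddfN => /eqP ex ->.
have [y yE] := ipure _ _ ex.
have xE : - x = y *+ p by apply: iI; rewrite -ex -yE raddfMn.
by rewrite -yE fi -cc' -raddfMn -xE raddfN addNr.
Qed.

Lemma perp_padic (p : nat) (G : zmodType) : prime p ->
  (forall g : G, g *+ p = 0 -> g = 0) -> perp (padic p) G.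
Proof.
move=> p_pr Gp; apply/perpP => E.
have [chi [chi0 chip chi_inj chi_surj]] := padic_characters p_pr.
pose i := ext_inj E.
(* Absence of p-torsion in [G] is used here: the image of [X] is p-pure. *)
have ipure e x : e *+ p = i x -> exists y, i y = e.
  move=> ex; apply/ext_exact/Gp.
  by rewrite -raddfMn ex; exact: ext_prj_inj.
pose T n := {f : {additive ext_mid E -> QZ} | forall x, f (i x) = chi n x}.
have step n (f : T n) : {f' : T n.+1 | forall e, sval f' e *+ p = sval f e}.
  case: f => f fi; apply: cid.
  have [f' [f'i f'f]] := extend_along_division divisible_QZ
    (@ext_injP _ _ E) ipure (chip n) fi.
  by exists (exist _ f' f'i).
(* The recursion starts at the zero map, which extends [chi 0] because [chi 0] vanishes. *)
have [z zE] : exists z : {additive ext_mid E -> QZ}, z =1 fun=> 0.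
  by apply: exists_additive => e e'; rewrite subr0.
have z0 x : z (i x) = chi 0%N x by rewrite zE chi0.
pose F := fix F n : T n :=
  if n is n'.+1 then sval (step n' (F n')) else exist _ z z0.
have FS n e : sval (F n.+1) e *+ p = sval (F n) e := svalP (step n (F n)) e.
have /choice[r rE] e : exists x, forall n, chi n x = sval (F n) e.
  by apply: chi_surj => [|n]; [apply: zE | apply: FS].
have [|g gE] := @exists_additive _ _ r.
  move=> e e'; apply/subr0_eq/chi_inj => n.
  by rewrite (raddfB (chi n)) (raddfB (chi n)) !rE (raddfB (sval (F n))) subrr.
exists g => x; apply/subr0_eq/chi_inj => n.
by rewrite raddfB gE rE (svalP (F n)); apply: subrr.
Qed.

(** * Chains of equations and extension to pure closures *)

(* For [t k = k + 1] this amounts to Ext(Q, X) = 0. *)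
Definition chain_solvable (X : zmodType) :=
  forall (t : nat -> int) (c : nat -> X),
    exists x : nat -> X, forall k, x k = x k.+1 *~ t k + c k.

Lemma chain_solvable_quot_finsupp : chain_solvable (quot_finsupp nat).
Proof.
move=> t c.
have [c' c'E] := choice (fun k => qproj_surj (c k)).
(* At coordinate [i], [w i j] is the unknown of index [i + 1 - j], reached by descending [j] steps
   from the value 0 at index [i + 1]. *)
pose w i := fix w j := if j is j'.+1 then w j' * t (i - j')%N + c' (i - j')%N i else 0 : int.
exists (fun k => qproj _ (fun i => w i (i.+1 - k)%N)) => k.
rewrite -c'E -raddfMz -raddfD; apply/subr0_eq; rewrite -raddfB.
(* Equation [k] can fail only at the finitely many coordinates [i < k]. *)
apply/qproj_eq0/asboolP; apply: sub_finite_set (finite_II k) => i /=.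
apply: contraNT; rewrite -leqNgt => ki; apply/eqP.
have subE (f g : nat -> int) : (f - g) i = f i - g i by [].
have addE (f g : nat -> int) : (f + g) i = f i + g i by [].
rewrite subE addE fct_mulrz subSn // subSS /= subKn //.
by rewrite -mulrzr intz subrr.
Qed.

Section PureStep.
Variables (E X : zmodType) (R : set (E * X)).
Hypotheses (Xchain : chain_solvable X).
Hypothesis (RP : partial_additive [set n : int | n != 0] R).
Variable a : E.

Let dom : set E := [set e | exists b, R (e, b)].

(** By purity [E / dom] is torsion-free. There [e k] generates the group of elements whose [k!]-th
    multiple lies in [Za]; values [x k] at the [e k] agree along the chain exactly when they solve
    the equations of [Xchain]. *)
Lemma pure_extension_step : ~ dom a ->
  exists2 R', partial_additive [set n : int | n != 0] R' &
    R `<=` R' /\ exists b, R' (a, b).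
Proof.
move=> doma.
have dom0 : dom 0 by exists 0; apply: pa0 RP.
have domB e e' : dom e -> dom e' -> dom (e - e').
  by move=> [b Rb] [b' Rb']; exists (b - b'); apply: (paB RP Rb Rb').
have domN e : dom e -> dom (- e) by rewrite -sub0r; apply: domB.
have domD e e' : dom e -> dom e' -> dom (e + e').
  by rewrite -{2}(opprK e') => ? /domN; apply: domB.
have domM e n : dom e -> dom (e *~ n).
  by move=> [b Rb]; exists (b *~ n); rewrite -pair_mulrz; apply: (paMz RP).
have domV e n : n != 0 -> dom (e *~ n) -> dom e.
  by move=> n0 [b Rb]; apply: (pa_pure RP) Rb.
(* Factorials give an increasing chain under divisibility that absorbs every nonzero integer. *)
pose N k : int := (k`!)%:Z.
have N0 k : N k != 0 by rewrite eqz_nat -lt0n fact_gt0.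
(* Modulo [dom], the multiples of [a] divisible by [N k] are those of [a *~ m k], and [e k] is the
   quotient of [a *~ m k] by [N k]. *)
have gen k : exists em : E * int, dom (em.1 *~ N k - a *~ em.2) /\
    forall e n, dom (e *~ N k - a *~ n) -> exists q, n = q * em.2.
  have [||m [e em] mgen] :=
    @int_subgroup_generator [set n | exists e, dom (e *~ N k - a *~ n)].
  - by exists 0; rewrite mul0rz mulr0z subrr.
  - move=> n n' [e en] [e' en']; exists (e - e').
    rewrite mulrzBl mulrzBr.
    have -> : e *~ N k - e' *~ N k - (a *~ n - a *~ n') =
        e *~ N k - a *~ n - (e' *~ N k - a *~ n').
      by rewrite !opprB addrACA [RHS]addrACA; congr (_ + _); apply: addrC.
    exact: domB.
  by exists (e, m); split=> // e' n e'n; apply: mgen; exists e'.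
have {gen}[em emP] := choice gen.
pose e k := (em k).1; pose m k := (em k).2.
have eP k : dom (e k *~ N k - a *~ m k) by case: (emP k).
have mgen k e' n : dom (e' *~ N k - a *~ n) -> exists q, n = q * m k.
  by case: (emP k) => _; apply.
have m0 k : m k != 0.
  have [|q qE] := mgen k a (N k); first by rewrite subrr.
  by apply: contra_neq (N0 k) => mk0; rewrite qE mk0 mulr0.
have cyc k e' n : dom (e' *~ N k - a *~ n) -> exists q, dom (e' - e k *~ q).
  move=> e'n; have [q nE] := mgen _ _ _ e'n; exists q.
  apply: (domV _ (N k)) => //.
  have -> : (e' - e k *~ q) *~ N k =
      (e' *~ N k - a *~ n) - (e k *~ N k - a *~ m k) *~ q.
    rewrite !mulrzBl (mulrzAC q) nE (mulrC q) mulrzA opprB addrA subrK.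
    by rewrite addrC.
  by apply: domB => //; apply: domM.
have /choice[t tP] k : exists q, dom (e k - e k.+1 *~ q).
  apply: (cyc _ _ (m k * k.+1%:Z)).
  have -> : N k.+1 = N k * k.+1%:Z by rewrite /N factS PoszM mulrC.
  by rewrite !mulrzA -mulrzBl; apply: domM.
have [c cP] := choice tP.
have [x xP] := Xchain t c.
pose u k : E * X := (e k, x k).
have uS k : R (u k - u k.+1 *~ t k).
  by rewrite pair_mulrz; move: (cP k); congr R; congr pair; rewrite /= xP addrAC subrr add0r.
have adjS k v : adjoin R (u k) v -> adjoin R (u k.+1) v.
  move=> [n Rn]; exists (t k * n); have := paD RP Rn (paMz RP n (uS k)).
  by rewrite mulrzBl mulrzA addrA subrK.
have adj_le k l v : (k <= l)%N -> adjoin R (u k) v -> adjoin R (u l) v.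
  by move=> /subnK <-; elim: (l - k)%N => // j IHj /IHj/adjS.
pose R' := [set v | exists k, adjoin R (u k) v].
exists R'; last first.
  split=> [v Rv|]; first by exists 0%N; apply: sub_adjoin.
  (* Since [N 0 = 1], stage 0 already contains [a]. *)
  have [|q [b Rb]] := cyc 0%N a 1; first by rewrite /N fact0 subrr.
  exists (b + x 0%N *~ q), 0%N, q.
  by move: Rb; congr R; rewrite pair_mulrz; congr pair; rewrite /= addrK.
split.
- by exists 0%N; apply/sub_adjoin/(pa0 RP).
- move=> v w [k Rk] [l Rl]; exists (maxn k l).
  by apply: (adjoinB RP); [apply: adj_le Rk | apply: adj_le Rl];
    rewrite ?leq_maxl ?leq_maxr.
- move=> b [k [n]]; rewrite pair_mulrz => Rn.
  (* A nonzero [n] is impossible: [e k *~ n] in [dom] would put [a *~ (m k * n)] there, hence [a] by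
     purity. *)
  have [n0|n0] := eqVneq n 0.
    by apply: (pa_fun RP); move: Rn; rewrite n0 !mulr0z subr0.
  case: doma; apply: (domV _ (m k * n)); first by rewrite mulf_neq0.
  have den : dom (e k *~ n).
    rewrite -[X in dom X]opprK; apply: domN; rewrite -sub0r.
    by exists (b - x k *~ n).
  have -> : a *~ (m k * n) = e k *~ n *~ N k - (e k *~ N k - a *~ m k) *~ n.
    by rewrite mulrzBl mulrzA [e k *~ N k *~ n]mulrzAC opprB addrC subrK.
  by apply: domB; apply: domM.
move=> n e' b n0 [k [q]]; rewrite pair_mulrz => Rq.
have de' : dom (e' *~ n - e k *~ q) by exists (b - x k *~ q).
(* With this [K], [n * N k] divides [K!], so the [K!]-th multiple of [e'] lies in [Za] modulo [dom]
   and [e'] is caught at stage [K]. *)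
pose K := (`|n| * k`!)%N.
have [s sE] : exists s, N K = n * N k * s.
  have /dvdzP[s sE] : (n * N k %| N K)%Z.
    rewrite dvdzE abszM; apply: dvdn_fact.
    by rewrite muln_gt0 absz_gt0 n0 fact_gt0 /=.
  by exists s; rewrite sE mulrC.
have [|q' [b' Rb']] := cyc K e' (m k * (q * s)).
  have -> : e' *~ N K - a *~ (m k * (q * s)) =
     (e' *~ n - e k *~ q) *~ (N k * s) + (e k *~ N k - a *~ m k) *~ (q * s).
    rewrite !mulrzBl sE !mulrzA -!(mulrzAC _ q) addrA; congr (_ - _).
    by rewrite [e k *~ q *~ _]mulrzAC subrK.
  by apply: domD; apply: domM.
exists (b' + x K *~ q'), K, q'.
by move: Rb'; congr R; rewrite pair_mulrz; congr pair; rewrite /= addrK.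
Qed.

End PureStep.

(** Torsion-freeness of [G] makes the image of [X] pure, so the inverse of the injection is a
    partial map with pure domain from which the extension can start. *)
Lemma perp_chain_solvable (X G : zmodType) : chain_solvable X ->
  (forall (n : int) (g : G), n != 0 -> g *~ n = 0 -> g = 0) -> perp X G.
Proof.
move=> Xchain Gtf; apply/perpP => E.
pose R := [set u : ext_mid E * X | u.1 = ext_inj E u.2].
have RP : partial_additive [set n : int | n != 0] R.
  rewrite /R; split=> /= [|[a b] [c d] /= -> ->|b|n a b n0 ab].
  - by rewrite raddf0.
  - by rewrite raddfB.
  - by rewrite -(raddf0 (ext_inj E)) => /ext_injP.
  have /ext_exact[c <-] : ext_prj E a = 0; last by exists c.
  by apply: (Gtf n) => //; rewrite -raddfMz ab; apply: ext_prj_inj.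
have [R' a R'P _|r rR] := partial_additive_extend RP; last first.
  by exists r => x; apply: rR.
have [Ra|Ra] := pselect (exists b, R' (a, b)); last exact: pure_extension_step.
by exists R'; last by split=> // u.
Qed.

(** * Elements not divisible by p, and the three equalities of classes *)

(** The constant function 1 differs from any multiple of [p] at every coordinate, hence at
    infinitely many. *)
Lemma quot_finsupp_indivisible (p : nat) : prime p ->
  exists x : quot_finsupp nat, forall y, y *+ p <> x.
Proof.
move=> p_pr; exists (qproj _ (fun=> 1)) => y.
have [f <-] := qproj_surj y => /eqP.
rewrite -raddfMn -subr_eq0 -raddfB => /eqP/qproj_eq0/asboolP.
suff -> : [set k | (f *+ p - (fun=> 1)) k != 0] = setT by apply: infinite_nat.
apply/seteqP; split=> // k _ /=.
have -> (g h : nat -> int) : (g - h) k = g k - h k by [].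
rewrite natmulfctE subr_eq0; apply: contraTneq p_pr => fp.
have /(congr1 absz) := fp; rewrite -mulr_natr abszM natz => /eqP.
by rewrite muln_eq1 absz_nat => /andP[_ /eqP->].
Qed.

(** The p-adic unit 1 works: its coordinate 0 is 1 in [Z/p], where multiples of [p] vanish. *)
Lemma padic_indivisible (p : nat) : prime p ->
  exists x : padic p, forall y, y *+ p <> x.
Proof.
move=> p_pr; have p1 := prime_gt1 p_pr.
have pX1 n : (1 < p ^ n.+1)%N by rewrite -(expn0 p) ltn_exp2l.
have oneP n : padic_proj (1 : 'Z_(p ^ n.+2)) = 1.
  by apply: val_inj; rewrite /= !modn_small // Zp_cast.
exists (Padic oneP) => y /(congr1 (fun x : padic p => x 0%N)) /=.
have coord0M n : (y *+ n) 0%N = y 0%N *+ n.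
  by elim: n => [|n IHn] //; rewrite !mulrS -IHn.
rewrite coord0M => /(congr1 val); rewrite Zp_mulrn /=.
by move: (nat_of_ord _) => k; rewrite Zp_cast // expn1 modnMl modn_small.
Qed.

Theorem theorem3p1 :
  [/\ forall G : zmodType, perp rat G,
      forall G : zmodType,
        perp (quot_finsupp nat) G <-> (forall p : nat, prime p -> perp (padic p) G) &
      forall (K : Type) (G : zmodType), perp (quot_bounded K) G <-> perp rat G].
Proof.
split=> [G|G|K G].
- exact/perp_divisible/divisible_rat.
- split=> [XG p p_pr|JG].
    apply: perp_padic => //.
    by have [x xp] := quot_finsupp_indivisible p_pr; apply: perp_torsion_free xp XG.
  apply: perp_chain_solvable; first exact: chain_solvable_quot_finsupp.
  have ptf p (g : G) : prime p -> g *+ p = 0 -> g = 0.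
    move=> p_pr; have [x xp] := padic_indivisible p_pr.
    exact: perp_torsion_free xp (JG p p_pr) _.
  (* Prime torsion controls all torsion: strong induction removes the least prime divisor of [n]. *)
  have ntf n (g : G) : (0 < n)%N -> g *+ n = 0 -> g = 0.
    elim/ltn_ind: n g => n IHn g n0 gn.
    have [n1|n1] := leqP n 1.
      by have n1' : n = 1%N; [apply/eqP; rewrite eqn_leq n1 | rewrite -gn n1'].
    apply: (ptf (pdiv n)); first exact: pdiv_prime.
    apply: (IHn (n %/ pdiv n)%N).
    - by rewrite ltn_Pdiv // prime_gt1 ?pdiv_prime.
    - by rewrite divn_gt0 ?pdiv_gt0 // pdiv_leq.
    - by rewrite -mulrnA mulnC divnK // pdiv_dvd.
  move=> [n|n] g n0 gn; first by apply: (ntf n) => //; rewrite lt0n.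
  by apply: (ntf n.+1) => //; apply/eqP; rewrite -oppr_eq0; apply/eqP.
- by split=> _; apply: perp_divisible; [apply: divisible_rat | apply: divisible_quot_bounded].
Qed.
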